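(* Let $G=(V,E)$ be any graph. (i) The map $[\tau]_\sim\mapsto X_\tau$ is a bijection between $\Upsilon/{\sim}$ and $\mathrm{crit}(G)$. (ii) For every critical $X\in\mathrm{crit}(G)$ the map $\tau\mapsto U(\tau,X)\cap 2^{\mathcal C_X(X)}$ is a bijection between the ultrafilter tangles $\tau$ with $X_\tau=X$ and the free ultrafilters on $\mathcal C_X(X)$. Moreover, the number of ultrafilter tangles $\tau$ with $X_\tau=X$ is $2^{2^\kappa}$, where $\kappa=|\mathcal C_X(X)|\ge\aleph_0$. (iii) $|\mathrm{crit}(G)|\le|V|$. (iv) $|\mathrm{crit}(G)|\cdot 2^{\mathfrak c}\le|\Upsilon|$, where $\mathfrak c=2^{\aleph_0}$.
   Context: $\mathcal X$ is the set of all finite subsets of $V$; for $X\in\mathcal X$, $\mathcal C_X$ is the set of components of $G-X$, and for $Y\subseteq X$, $\mathcal C_X(Y)$ is the set of those $C\in\mathcal C_X$ with neighbourhood $N(C)=Y$. $X\in\mathcal X$ is critical if $\mathcal C_X(X)$ is infinite; $\mathrm{crit}(G)$ is the set of critical $X\in\mathcal X$. For $\mathcal C\subseteq\mathcal C_X$ put $V[\mathcal C]=\bigcup_{C\in\mathcal C}V(C)$ and $s_{X\to\mathcal C}=(V\setminus V[\mathcal C],X\cup V[\mathcal C])$. $\vec S$ is the set of all oriented finite order separations of $G$: ordered pairs $(A,B)$ with $A\cup B=V$, $A\cap B$ finite and no edge between $A\setminus B$ and $B\setminus A$. $(A,B)\le(C,D)$ means $A\subseteq C$ and $B\supseteq D$.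 A star is a set $\sigma\subseteq\vec S$ such that any two distinct $(A,B),(D,C)\in\sigma$ satisfy $(A,B)\le(C,D)$; its interior is $\bigcap_{(A,B)\in\sigma}B$. An $\aleph_0$-tangle of $G$ is a set $\tau\subseteq\vec S$ containing exactly one of $(A,B),(B,A)$ for every finite order separation $\{A,B\}$, that is consistent (no two distinct $(B,A),(C,D)\in\tau$ satisfy $(A,B)<(C,D)$) and has no finite star of finite interior as a subset. For an $\aleph_0$-tangle $\tau$ and $X\in\mathcal X$, $U(\tau,X)=\{\mathcal C\subseteq\mathcal C_X\mid s_{X\to\mathcal C}\in\tau\}$, which is an ultrafilter on $\mathcal C_X$. $\mathcal X_\tau$ is the set of $X\in\mathcal X$ for which $U(\tau,X)$ is free (non-principal). $\tau$ is an ultrafilter tangle if $\mathcal X_\tau\neq\emptyset$; $\Upsilon$ is the set of ultrafilter tangles. For $\tau\in\Upsilon$ the set $\mathcal X_\tau$ has a least element, denoted $X_\tau$, and $\mathcal X_\tau=\{X\in\mathcal X\mid X\supseteq X_\tau\}$ (a known fact due to Diestel). On $\Upsilon$ let $\tau\sim\tau'$ if and only if $X_\tau=X_{\tau'}$. *)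

(* Defs.v *)
From Stdlib Require Import Relation_Operators.
From mathcomp Require Import all_boot.
From mathcomp Require Import boolp classical_sets functions cardinality filter.

Set Implicit Arguments.
Unset Strict Implicit.
Unset Printing Implicit Defensive.

Local Open Scope classical_set_scope.

Record graph (V : Type) := Graph {
  adj : V -> V -> Prop;
  adj_sym : forall u v, adj u v -> adj v u;
  adj_irrefl : forall v, ~ adj v v }.

Section UltrafiltersOnSets.
Context {T : Type}.
Implicit Types (A B : set T) (F : set (set T)).

(* An ultrafilter on a subset A of T is a set of subsets of A; [UltraFilter]
   is about a whole type, here the subtype of the elements of A. *)
Definition ultrafilter_on A F : Prop :=
  F `<=` [set B | B `<=` A] /\
  UltraFilter [set B : set A | F (set_val @` B)].

Definition principal_on A F : Prop :=
  exists2 a, A a & F = [set B | B `<=` A /\ B a].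

Definition free_on A F : Prop := ~ principal_on A F.

Definition free_ultrafilters A : set (set (set T)) :=
  [set F | ultrafilter_on A F /\ free_on A F].

End UltrafiltersOnSets.

Section Tangles.
Context {V : Type} (G : graph V).
Implicit Types (X Y C : set V) (CC : set (set V)).
Implicit Types (s t : set V * set V) (sigma tau : set (set V * set V)).

(* The subgraph of G induced by C is connected (and not null). *)
Definition connected_in C : Prop :=
  C !=set0 /\
  forall u v, C u -> C v ->
    clos_refl_trans V (fun x y => [/\ C x, C y & adj G x y]) u v.

(* A component of G - X is an induced subgraph; it is identified with its
   vertex set. *)
Definition components X : set (set V) :=
  [set C | [/\ C `<=` ~` X, connected_in C &
    forall D, D `<=` ~` X -> connected_in D -> C `<=` D -> D = C]].

Definition neighbourhood C : set V :=
  [set v | ~ C v /\ exists2 u, C u & adj G u v].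

Definition components_at X Y : set (set V) :=
  [set C | components X C /\ neighbourhood C = Y].

Definition crit : set (set V) :=
  [set X | finite_set X /\ infinite_set (components_at X X)].

Definition sep_to X CC : set V * set V :=
  (~` \bigcup_(C in CC) C, X `|` \bigcup_(C in CC) C).

Definition separations : set (set V * set V) :=
  [set s | [/\ s.1 `|` s.2 = setT, finite_set (s.1 `&` s.2) &
    forall u v, (s.1 `\` s.2) u -> (s.2 `\` s.1) v -> ~ adj G u v]].

Definition sep_inv s : set V * set V := (s.2, s.1).

Definition sep_le s t : Prop := s.1 `<=` t.1 /\ t.2 `<=` s.2.

Definition sep_lt s t : Prop := sep_le s t /\ s <> t.

Definition star sigma : Prop :=
  sigma `<=` separations /\
  forall s t, sigma s -> sigma t -> s <> t -> sep_le s (sep_inv t).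

Definition interior sigma : set V := \bigcap_(s in sigma) s.2.

Definition consistent tau : Prop :=
  forall s t, tau s -> tau t -> s <> t -> ~ sep_lt (sep_inv s) t.

Definition aleph0_tangle tau : Prop :=
  [/\ tau `<=` separations,
      forall s, separations s -> exists! t, tau t /\ [set s; sep_inv s] t,
      consistent tau &
      forall sigma, star sigma -> finite_set sigma ->
        finite_set (interior sigma) -> ~ sigma `<=` tau].

Definition tangle_filter tau X : set (set (set V)) :=
  [set CC | CC `<=` components X /\ tau (sep_to X CC)].

Definition free_sets tau : set (set V) :=
  [set X | finite_set X /\ free_on (components X) (tangle_filter tau X)].

Definition ultrafilter_tangles : set (set (set V * set V)) :=
  [set tau | aleph0_tangle tau /\ free_sets tau !=set0].

(* The least element of [free_sets tau] with respect to inclusion (the default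
   value [set0] is irrelevant for ultrafilter tangles). *)
Definition least_free_set tau : set V :=
  xget set0 [set X | free_sets tau X /\ forall Y, free_sets tau Y -> X `<=` Y].

Definition tangle_equiv tau tau' : Prop :=
  least_free_set tau = least_free_set tau'.

Definition tangle_class tau : set (set (set V * set V)) :=
  [set tau' | ultrafilter_tangles tau' /\ tangle_equiv tau tau'].

Definition tangle_quotient : set (set (set (set V * set V))) :=
  tangle_class @` ultrafilter_tangles.

Definition tangles_at X : set (set (set V * set V)) :=
  [set tau | ultrafilter_tangles tau /\ least_free_set tau = X].

End Tangles.

(* Main.v *)
(* For a critical set X and a free ultrafilter F on the infinite set K of
   components C with N(C) = X, put into tau(X, F) every finite order separation
   (A, B) such that F contains the set of all C in K with C <= B - A.  As all
   but finitely many members of K avoid the finite set A /\ B, exactly one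
   orientation is chosen; finitely many members of tau(X, F) have infinitely
   many members of K in all their big sides, so tau(X, F) is an aleph_0-tangle.
   If Y is finite and misses some x in X, then x and almost all of K lie in one
   component of G - Y, making U(tau, Y) principal; so X is the least free set.
   Conversely, if U(tau, X0) is free, then it contains the set of components of
   G - X0 with neighbourhood X for a single X <= X0; this X is critical, and
   tau = tau(X, F) for the trace F of U(tau, X), because corners of separations
   yield finite stars of finite interior.
   The number of free ultrafilters comes from an independent family of subsets
   of Fin(K) * Fin(Fin(K)) (Hausdorff, Pospisil), and |crit(G)| <= |V| from
   |Fin(V)| = |V|; both rest on Hessenberg's theorem |T * T| = |T|. *)
Require Import Defs.
From Stdlib Require Import Relation_Operators.
From mathcomp Require Import all_boot.
From mathcomp Require Import boolp classical_sets functions cardinality filter.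

Set Implicit Arguments.
Unset Strict Implicit.
Unset Printing Implicit Defensive.

Local Open Scope classical_set_scope.
Local Open Scope card_scope.

(** * Cardinal arithmetic *)

(** Zorn's lemma gives a maximal partial injection, stored as its graph [R]. If points [a] of A and
    [b] of B were both unmatched, the pair [(a, b)] could be added. *)
Lemma inj_comparable T (A B : set T) :
  (exists2 f : T -> T, set_fun A B f & set_inj A f) \/
  (exists2 f : T -> T, set_fun B A f & set_inj B f).
Proof.
pose P (R : set (T * T)) := (forall p, R p -> A p.1 /\ B p.2) /\
  (forall p q, R p -> R q -> p.1 = q.1 <-> p.2 = q.2).
have [R [[RAB Rinj] Rmax]] : exists R, P R /\ forall S, R `<` S -> ~ P S.
  apply: Zorn_bigcup => F FP Ftot; split.
    by move=> p [X FX Xp]; exact: (FP _ FX).1.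
  move=> p q [X FX Xp] [Y FY Yq].
  have [XY|YX] := Ftot _ _ FX FY.
    by apply: (FP _ FY).2 => //; exact: XY.
  by apply: (FP _ FX).2 => //; exact: YX.
have [domA|/existsNP[a /not_implyP[Aa na]]] :=
    pselect (forall a, A a -> exists b, R (a, b)).
  left; have /choice[f Rf] : forall a, exists b, A a -> R (a, b).
    move=> a; have [/domA[b Rab]|nAa] := pselect (A a); first by exists b.
    by exists a.
  exists f => [a Aa|a a' /set_mem Aa /set_mem Aa' faa'].
    exact: (RAB _ (Rf _ Aa)).2.
  exact: (Rinj _ _ (Rf _ Aa) (Rf _ Aa')).2.
have [domB|/existsNP[b /not_implyP[Bb nb]]] :=
    pselect (forall b, B b -> exists a, R (a, b)).
  right; have /choice[f Rf] : forall b, exists a, B b -> R (a, b).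
    move=> b; have [/domB[c Rcb]|nBb] := pselect (B b); first by exists c.
    by exists b.
  exists f => [b Bb|b b' /set_mem Bb /set_mem Bb' fbb'].
    exact: (RAB _ (Rf _ Bb)).1.
  exact: (Rinj _ _ (Rf _ Bb) (Rf _ Bb')).1.
exfalso; apply: (Rmax (R `|` [set (a, b)])).
  split; first by move=> p Rp; left.
  by move=> /(_ (a, b) (or_intror erefl)) Rab; apply: na; exists b.
split=> [p [/RAB //|-> //]|[x y] [x' y'] [Rp|[-> ->]] [Rq|[-> ->]] //=].
- exact: Rinj Rp Rq.
- split=> [xa|yb]; first by exfalso; apply: na; exists y; rewrite -xa.
  by exfalso; apply: nb; exists x; rewrite -yb.
- split=> [xa|yb]; first by exfalso; apply: na; exists y'; rewrite xa.
  by exfalso; apply: nb; exists x'; rewrite yb.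
Qed.

(* [pairing_graph R] says that [R] is the graph of an injection of A * A into A,
   where A is [graph_diag R]; Hessenberg's theorem applies Zorn's lemma to such
   graphs. *)
Definition graph_diag T (R : set (T * T * T)) : set T :=
  [set a | exists c, R (a, a, c)].

Definition pairing_graph T (R : set (T * T * T)) : Prop :=
  [/\ forall p, R p -> [/\ graph_diag R p.1.1, graph_diag R p.1.2 &
        graph_diag R p.2],
      forall a b, graph_diag R a -> graph_diag R b -> exists c, R (a, b, c) &
      forall p q, R p -> R q -> p.1 = q.1 <-> p.2 = q.2].

(** The chain condition for Zorn's lemma: two triples, or two diagonal points, taken from members of
    a chain already lie in a single member. *)
Lemma pairing_graph_bigcup T (F : set (set (T * T * T))) :
  F !=set0 -> F `<=` @pairing_graph T -> total_on F subset ->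
  pairing_graph (\bigcup_(R in F) R).
Proof.
move=> [R0 FR0] FP Ftot; split.
- move=> p [R FR Rp]; have [+ _ _] := FP _ FR.
  by move=> /(_ _ Rp)[[a ?] [b ?] [c ?]]; split; [exists a|exists b|exists c];
    exists R.
- move=> a b [c [R FR Rac]] [d [S FS Sbd]].
  wlog RS : a b c d R S FR FS Rac Sbd / R `<=` S => [wlg|].
    have [RS|SR] := Ftot _ _ FR FS; first exact: (wlg a b c d R S).
    have [_ + _] := FP _ FR => /(_ a b)[||e Re]; first by exists c.
      by exists d; exact: SR.
    by exists e; exists R.
  have [_ + _] := FP _ FS => /(_ a b)[||e Re]; first by exists c; exact: RS.
    by exists d.
  by exists e; exists S.
- move=> p q [R FR Rp] [S FS Sq]; have [RS|SR] := Ftot _ _ FR FS.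
    by have [_ _ +] := FP _ FS; apply => //; exact: RS.
  by have [_ _ +] := FP _ FR; apply => //; exact: SR.
Qed.

Lemma pairing_graph_fun T (R : set (T * T * T)) : pairing_graph R ->
  exists p : T -> T -> T,
    [/\ forall a b, graph_diag R a -> graph_diag R b -> R (a, b, p a b),
        forall a b, graph_diag R a -> graph_diag R b -> graph_diag R (p a b) &
        forall a b a' b', graph_diag R a -> graph_diag R b ->
          graph_diag R a' -> graph_diag R b' ->
          p a b = p a' b' -> a = a' /\ b = b'].
Proof.
move=> [RD Rtot Rinj].
have /choice[p Rp] : forall ab : T * T, exists c,
    graph_diag R ab.1 -> graph_diag R ab.2 -> R (ab, c).
  move=> [a b]; have [/= Da|nDa] := pselect (graph_diag R a); last by exists a.
  have [/= Db|nDb] := pselect (graph_diag R b); last by exists a.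
  by have [c Rc] := Rtot _ _ Da Db; exists c.
exists (fun a b => p (a, b)); split=> [a b||a b a' b' Da Db Da' Db' pE].
- exact: (Rp (a, b)).
- by move=> a b Da Db; have [] := RD _ (Rp (a, b) Da Db).
- have [_ /(_ pE)[-> ->] //] :=
    Rinj _ _ (Rp (a, b) Da Db) (Rp (a', b') Da' Db').
Qed.

(** The growth step of Hessenberg's theorem: a pairing on the diagonal D is not maximal as long as
    the complement contains a copy of D. Three disjoint copies of D * D fit into D by means of the
    given pairing and distinct labels [d n]. *)
Lemma pairing_graph_extend T (R : set (T * T * T)) (e : T -> T) (d : nat -> T):
  pairing_graph R -> injective d -> (forall n, graph_diag R (d n)) ->
  set_fun (graph_diag R) (~` graph_diag R) e -> set_inj (graph_diag R) e ->
  exists2 S, R `<` S & pairing_graph S.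
Proof.
move=> Rpair dinj Dd eD einj; set D := graph_diag R in eD einj.
have [p [Rp Dp pinj]] := pairing_graph_fun Rpair.
have [RD Rtot Rinj] := Rpair.
pose g (i : bool) x := if i then e x else x.
have gD i x : D x -> D (g i x) -> i = false.
  by case: i => //= Dx; have := eD _ Dx.
have ginj i x j y : D x -> D y -> g i x = g j y -> i = j /\ x = y.
  case: i j => [] [] //= Dx Dy.
  - by move=> exy; split => //; apply: einj; rewrite ?inE.
  - by move=> E; have := eD _ Dx; rewrite E.
  - by move=> E; have := eD _ Dy; rewrite -E.
(* [g false] and [g true] parametrise D and its copy e(D); the three new blocks
   of (D + e(D))^2 are coded into e(D), with the block number stored by [d]. *)
pose w (i j : bool) x y := e (p (p x y) (d (i.*2 + j))).
have Dpp (i j : bool) x y : D x -> D y -> D (p (p x y) (d (i.*2 + j))).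
  by move=> Dx Dy; apply: (Dp _ _ (Dp _ _ Dx Dy)); exact: Dd.
pose N := [set q : T * T * T | exists i j x y, [/\ i || j, D x, D y &
  q = (g i x, g j y, w i j x y)]].
have DRN u : graph_diag (R `|` N) u <-> exists i x, D x /\ u = g i x.
  split=> [[v [Ru|[i [j [x [y [_ Dx _ [-> _ _]]]]]]]]|[[] [x [Dx ->]]]].
  - by exists false, u; split => //; exists v.
  - by exists i, x.
  - by exists (w true true x x); right; exists true, true, x, x.
  - by have [v Rv] := Dx; exists v; left.
(* Old and new triples differ both in their arguments and in their values, so the last clause of
   [pairing_graph] can be checked within [R] and within [N]. *)
have NRfst q : N q -> ~ (D q.1.1 /\ D q.1.2).
  move=> [i [j [x [y [ij Dx Dy ->]]]]] /= [/(gD _ _ Dx) i0 /(gD _ _ Dy) j0].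
  by rewrite i0 j0 in ij.
have NRsnd q : N q -> ~ D q.2.
  move=> [i [j [x [y [ij Dx Dy ->]]]]] /=; apply: eD; exact: Dpp.
exists (R `|` N).
  split; first by move=> q Rq; left.
  move=> NR; pose q := (e (d 0), e (d 0), w true true (d 0) (d 0)).
  have Nq : N q by exists true, true, (d 0), (d 0); split => //; exact: Dd.
  by have [D1 D2 _] := RD _ (NR q (or_intror Nq)); exact: (NRfst q).
split.
- move=> q [/RD[D1 D2 D3]|[i [j [x [y [ij Dx Dy ->]]]]]]; split; apply/DRN.
  + by exists false, q.1.1.
  + by exists false, q.1.2.
  + by exists false, q.2.
  + by exists i, x.
  + by exists j, y.
  + by exists true, (p (p x y) (d (i.*2 + j))); split => //; exact: Dpp.
- move=> a b /DRN[i [x [Dx ->]]] /DRN[j [y [Dy ->]]].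
  have [ij|/norP[/negbTE-> /negbTE->]] := boolP (i || j).
    by exists (w i j x y); right; exists i, j, x, y.
  by exists (p x y); left; exact: Rp.
- move=> q r [Rq|Nq] [Rr|Nr].
  + exact: Rinj.
  + split=> E; exfalso.
      by apply: (NRfst _ Nr); rewrite -E; have [] := RD _ Rq.
    by apply: (NRsnd _ Nr); rewrite -E; have [] := RD _ Rq.
  + split=> E; exfalso.
      by apply: (NRfst _ Nq); rewrite E; have [] := RD _ Rr.
    by apply: (NRsnd _ Nq); rewrite E; have [] := RD _ Rr.
  + move: Nq Nr => [i [j [x [y [ij Dx Dy ->]]]]].
    move=> [i' [j' [x' [y' [_ Dx' Dy' ->]]]]]; split=> /= [[]|E].
      by move=> /(ginj _ _ _ _ Dx Dx')[-> ->] /(ginj _ _ _ _ Dy Dy')[-> ->].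
    have /pinj[||||] : p (p x y) (d (i.*2 + j)) = p (p x' y') (d (i'.*2 + j')).
    * by apply: einj; rewrite ?inE //; exact: Dpp.
    * exact: Dp.
    * exact: Dd.
    * exact: Dp.
    * exact: Dd.
    move=> /pinj[] // -> -> /dinj.
    by case: i {ij E}; case: j; case: i'; case: j'.
Qed.

Lemma infinite_injection T : infinite_set [set: T] ->
  exists d : nat -> T, injective d.
Proof.
move=> /infiniteP; elim/Ppointed: T => T.
  by rewrite !emptyE => /(congr1 (@^~ 0%N))/=; rewrite propeqE => -[].
by move=> /pcard_injP[d dinj]; exists d => x y; apply: dinj; rewrite inE.
Qed.

(** Hessenberg's theorem. For a maximal pairing graph with diagonal D, the complement of D cannot
    contain a copy of D, so by comparability it injects into D; then T injects into two copies of D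
    and hence into D. *)
Lemma infinite_pairing T : infinite_set [set: T] ->
  exists p : T * T -> T, injective p.
Proof.
move=> /infinite_injection[d dinj].
pose R0 := [set (d q.1, d q.2, d (pickle q)) | q in [set: nat * nat]].
have DR0 x : graph_diag R0 x <-> exists n, x = d n.
  split=> [[y [[i j] _ [<- _ _]]]|[n ->]]; first by exists i.
  by exists (d (pickle (n, n))), (n, n).
have R0P : pairing_graph R0.
  split=> [q [[i j] _ <-]|a b /DR0[i ->] /DR0[j ->]|].
  - by split; apply/DR0; eexists; reflexivity.
  - by exists (d (pickle (i, j))), (i, j).
  - move=> q r [[i j] _ <-] [[k l] _ <-].
    split=> [[/dinj-> /dinj->] //|/dinj/(pcan_inj (@pickleK _))[-> ->] //].
(* The maximal graph must contain the countable [R0], so that D is infinite. As a condition on R,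
   containing [R0] fails for the union of the empty chain; adjoining [R0] avoids this. *)
pose P R := pairing_graph (R0 `|` R).
have [R [PR Rmax]] : exists R, P R /\ forall S, R `<` S -> ~ P S.
  apply: Zorn_bigcup => F FP Ftot; rewrite /P.
  have -> : R0 `|` \bigcup_(R in F) R =
      \bigcup_(R in [set R0] `|` [set R0 `|` R | R in F]) R.
    apply/seteqP; split=> [q [R0q|[R FR Rq]]|q [_ [->|[R FR <-]] Rq]].
    - by exists R0 => //; left.
    - by exists (R0 `|` R); [right; exists R|right].
    - by left.
    - by case: Rq => [|Rq]; [left|right; exists R].
  apply: pairing_graph_bigcup; first by exists R0; left.
    by move=> _ [->|[R FR <-]] //; exact: FP.
  move=> _ _ [->|[R FR <-]] [->|[S FS <-]]; first by left.
  - by left => x; left.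
  - by right => x; left.
  by case: (Ftot _ _ FR FS) => RS; [left|right]; apply: setUS.
set M := R0 `|` R in PR.
have Dd n : graph_diag M (d n).
  by have [|c R0c] := (DR0 (d n)).2; [exists n|exists c; left].
have [[f fD finj]|[f fD finj]] :=
    inj_comparable (graph_diag M) (~` graph_diag M).
  have [S [MS nSM] SP] := pairing_graph_extend PR dinj Dd fD finj.
  exfalso; apply: (Rmax S); last first.
    rewrite /P (_ : R0 `|` S = S) //; apply/setUidPr => q R0q.
    by apply: MS; left.
  split=> [q Rq|SR]; first by apply: MS; right.
  by apply: nSM => q /SR; right.
have [p [_ pD pinj]] := pairing_graph_fun PR.
(* The tags [d 0] and [d 1] keep D apart from the image of its complement. *)
pose h x := if pselect (graph_diag M x) then p (d 0) x else p (d 1) (f x).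
have hD x : graph_diag M (h x).
  by rewrite /h; case: pselect => Dx; apply: pD => //; exact: fD.
have hinj : injective h.
  move=> x y; rewrite /h; case: pselect => Dx; case: pselect => Dy.
  - by move=> /pinj[].
  - by move=> /pinj[||||/dinj] //; exact: fD.
  - by move=> /pinj[||||/dinj] //; exact: fD.
  - move=> /pinj[]; [exact: Dd|exact: fD|exact: Dd|exact: fD|].
    by move=> _; apply: finj; rewrite inE.
exists (fun q => p (h q.1) (h q.2)) => -[x y] [x' y'] /=.
by move=> /pinj[] // /hinj-> /hinj->.
Qed.

(** Folding the pairing over a sequence is sure to be injective only among sequences of equal
    length, so the length is stored as well. *)
Lemma infinite_seq_injection T : infinite_set [set: T] ->
  exists s : seq T -> T, injective s.
Proof.
move=> Tinf; have [p pinj] := infinite_pairing Tinf.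
have [d dinj] := infinite_injection Tinf.
pose s := foldr (fun x y => p (x, y)) (d 0).
exists (fun l => p (d (size l), s l)) => l l' /pinj[/dinj].
elim: l l' => [|x l IH] [|x' l'] //= [E] /pinj[-> ss].
by rewrite (IH l').
Qed.

(** * Ultrafilters *)

Section ElementaryUltrafilters.
Context {T : Type}.
Implicit Types (A B C : set T) (F : set (set T)).

(** Trades the subtype for closure properties of sets of subsets of A, from which the lemmas below
    are drawn. *)
Lemma ultrafilter_onP A F : ultrafilter_on A F <->
  [/\ forall B, F B -> B `<=` A, ~ F set0,
      forall B C, F B -> F C -> F (B `&` C),
      forall B C, F B -> B `<=` C -> C `<=` A -> F C &
      forall B, B `<=` A -> F B \/ F (A `\` B)].
Proof.
have valK B : B `<=` A -> set_val @` (set_val @^-1` B : set A) = B.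
  move=> BA; apply/seteqP; split=> [_ [x Bx <-] //|x Bx].
  by exists (SigSub (mem_set (BA _ Bx))).
have imK (B : set A) : set_val @^-1` (set_val @` B) = B.
  apply/seteqP; split=> [x [y By /val_inj <-] //|x Bx]; by exists x.
split=> [[FA FU]|[FA F0 FI FS FC]].
  split=> //.
  - move=> F0; apply: (@filter_not_empty _ [set B : set A | F (set_val @` B)] _).
    by rewrite /= image_set0.
  - move=> B C FB FC; have BA := FA _ FB; have CA := FA _ FC.
    have := @filterI _ [set B : set A | F (set_val @` B)] _
      (set_val @^-1` B) (set_val @^-1` C).
    rewrite -preimage_setI /= !valK //; first exact.
    by move=> x [/BA].
  - move=> B C FB BC CA; have BA := FA _ FB.
    have := @filterS _ [set B : set A | F (set_val @` B)] _
      (set_val @^-1` B) (set_val @^-1` C).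
    by rewrite /= !valK //; apply => // x /BC.
  - move=> B BA.
    have [] := in_ultra_setVsetC (set_val @^-1` B) FU; rewrite /= ?valK //.
      by left.
    move=> FnB; right.
    rewrite (_ : _ `\` _ = set_val @` (~` (set_val @^-1` B) : set A)) //.
    apply/seteqP; split=> [x [Ax nBx]|_ [x nBx <-]].
      by exists (SigSub (mem_set Ax)).
    by split => //; exact: set_valP.
split; first by move=> B /FA.
split.
  split=> /=; first by rewrite image_set0.
  split=> /=.
  - have [|] := FC A (@subset_refl _ A); last by rewrite setDv.
    rewrite -{1}(valK A) // (_ : _ @^-1` _ = setT) //.
    by apply/seteqP; split=> // x _; exact: set_valP.
  - move=> B C FB FC' /=.
    suff -> : set_val @` (B `&` C) = set_val @` B `&` set_val @` C :> set T.
      exact: FI.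
    apply/seteqP; split=> [_ [x [Bx Cx] <-]|_ [[x Bx <-] [y Cy /val_inj xy]]].
      by split; exists x.
    by exists x => //; split=> //; rewrite -xy.
  - move=> B C BC FB; apply: FS FB _ _; first exact: image_subset.
    exact: sub_setP.
move=> G GP FG; apply/seteqP; split=> // B GB.
have [//|] := FC _ (@sub_setP _ _ B).
move=> FnB; exfalso; apply: (@filter_not_empty _ G _).
rewrite -(setICr B); apply: filterI => //; apply: FG => /=.
apply: FS FnB _ _; last exact: sub_setP.
move=> x [Ax nBx]; exists (SigSub (mem_set Ax)) => // Bx.
by apply: nBx; exists (SigSub (mem_set Ax)).
Qed.

Section Theory.
Context {A : set T} {F : set (set T)}.
Hypothesis FU : ultrafilter_on A F.

Lemma ultra_sub B : F B -> B `<=` A.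
Proof. by have [+ _ _ _ _] := (ultrafilter_onP A F).1 FU; apply. Qed.

Lemma ultra_set0 : ~ F set0.
Proof. by have [] := (ultrafilter_onP A F).1 FU. Qed.

Lemma ultraI B C : F B -> F C -> F (B `&` C).
Proof. by have [_ _ + _ _] := (ultrafilter_onP A F).1 FU; apply. Qed.

Lemma ultraS B C : F B -> B `<=` C -> C `<=` A -> F C.
Proof. by have [_ _ _ + _] := (ultrafilter_onP A F).1 FU; apply. Qed.

Lemma ultraVD B : B `<=` A -> F B \/ F (A `\` B).
Proof. by have [_ _ _ _ +] := (ultrafilter_onP A F).1 FU; apply. Qed.

Lemma ultraN0 B : F B -> B !=set0.
Proof. by move=> FB; apply/set0P/eqP => B0; apply: ultra_set0; rewrite -B0. Qed.

Lemma ultraU B C : F (B `|` C) -> F B \/ F C.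
Proof.
move=> FBC; have BCA := ultra_sub FBC.
have [||FnB] := @ultraVD B; [by move=> x Bx; apply: BCA; left|by left|right].
apply: (ultraS (ultraI FBC FnB)); last by move=> x Cx; apply: BCA; right.
by move=> x [[] // Bx [_]].
Qed.

Lemma ultra_bigcup I (D : set I) (B : I -> set T) : finite_set D ->
  F (\bigcup_(i in D) B i) -> exists2 i, D i & F (B i).
Proof.
move=> [n]; elim: n D => [|n IH] D.
  by rewrite II0 card_eq0 => /eqP->; rewrite bigcup_set0 => /ultra_set0.
move=> /eq_cardSP[x Dx Dn].
rewrite (_ : \bigcup_(i in D) _ = B x `|` \bigcup_(i in D `\ x) B i).
  move=> /ultraU[|/(IH _ Dn)[i [Di _] FBi]]; first by exists x.
  by exists i.
apply/seteqP; split=> [t [i Di Bt]|t [|[i [Di _]]]]; [|by exists x|by exists i].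
have [<-|ix] := pselect (i = x); first by left.
by right; exists i => //; split.
Qed.

Lemma ultra_bigcap I (D : set I) (B : I -> set T) : finite_set D ->
  (forall i, D i -> F (B i)) -> F (A `&` \bigcap_(i in D) B i).
Proof.
move=> Dfin FB; have [] := @ultraVD (A `&` \bigcap_(i in D) B i) => //.
rewrite (_ : _ `\` _ = \bigcup_(i in D) (A `\` B i)).
  move=> /(ultra_bigcup Dfin)[i Di FnBi]; exfalso; apply: ultra_set0.
  rewrite -(setDIK (B i) A) setIC; apply: ultraI => //.
  exact: FB.
rewrite setDIr setDv set0U; apply/seteqP; split=> x => [[Ax]|[i Di [Ax Bx]]].
  by move=> /existsNP[i] /not_implyP[Di Bi]; exists i.
by split => // /(_ i Di).
Qed.

Lemma ultra_freeP : free_on A F <-> forall a, ~ F [set a].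
Proof.
split=> [Ffree a Fa|Fn [a Aa FE]]; last first.
  by apply: (Fn a); rewrite FE; split=> // x ->.
have Aa := ultra_sub Fa (erefl : [set a] a).
apply: Ffree; exists a => //; apply/seteqP; split=> [B FB|B [BA Ba]].
  split; first exact: ultra_sub.
  by have [_ [-> Ba]] := ultraN0 (ultraI Fa FB).
by apply: ultraS Fa _ BA => x ->.
Qed.

Lemma ultrafilter_on_restrict K : F K ->
  ultrafilter_on K (F `&` [set B | B `<=` K]).
Proof.
move=> FK; have KA := ultra_sub FK; apply/ultrafilter_onP; split.
- by move=> B [].
- by move=> [/ultra_set0].
- by move=> B C [FB BK] [FC CK]; split; [exact: ultraI|move=> x [/BK]].
- move=> B C [FB BK] BC CK; split=> //.
  by apply: ultraS FB BC (subset_trans CK KA).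
- move=> B BK; have [FB|FnB] := ultraVD (subset_trans BK KA); [by left|right].
  split; last by move=> x [].
  by apply: (ultraS (ultraI FK FnB)) => [x [? []]|x [/KA]].
Qed.

Lemma ultra_free_infinite B : free_on A F -> F B -> infinite_set B.
Proof.
move=> /ultra_freeP Fn FB /(ultra_bigcup (B := fun x => [set x])).
by rewrite bigcup_imset1 image_id => /(_ FB)[x _ /Fn].
Qed.

End Theory.
End ElementaryUltrafilters.

(** * Independent families and the number of free ultrafilters *)

Lemma independent_family (T : Type) :
  exists ind : set T -> set (seq T * seq (seq T)),
    forall D (P : set (set T)), finite_set D ->
    exists w, forall S, D S -> ind S w <-> P S.
Proof.
elim/Pchoice: T => T.
(* (p, q) belongs to the set attached to S when the trace of S on p is in q. *)
exists (fun S => [set w | [seq x <- w.1 | `[< S x >]] \in w.2]) => D P Dfin.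
(* [sep] picks a point telling two sets apart. As D is finite, these points form a finite [p] on
   which distinct members of D have distinct traces; [q] lists the traces of those in P. *)
have /choice[sep sepP] : forall SS : set T * set T, exists s : seq T,
    SS.1 <> SS.2 -> exists2 x, x \in s & ~ (SS.1 x <-> SS.2 x).
  move=> [S S'] /=; have [->|SS'] := pselect (S = S'); first by exists [::].
  have [x nx] : exists x, ~ (S x <-> S' x).
    apply: contra_notP SS' => nx; apply/seteqP; split=> x Sx;
      by apply: contrapT => nSx; apply: nx; exists x => -[]; tauto.
  by exists [:: x] => _; exists x => //; rewrite mem_head.
have /finite_seqP[l lE] := finite_image sep (finite_setX Dfin Dfin).
pose p := flatten l; pose tr (S : set T) := [seq x <- p | `[< S x >]].
have tr_inj S S' : D S -> D S' -> tr S = tr S' -> S = S'.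
  move=> DS DS' trE; apply: contrapT => /(sepP (S, S'))[x xs]; apply.
  have xp : x \in p.
    apply/flattenP; exists (sep (S, S')) => //.
    suff : [set` l] (sep (S, S')) by [].
    by rewrite -lE; exists (S, S').
  have : (x \in tr S) = (x \in tr S') by rewrite trE.
  rewrite !mem_filter xp !andbT => SS'.
  by split=> /asboolP; [rewrite SS'|rewrite -SS'] => /asboolP.
have /finite_seqP[q qE] := finite_image tr (finite_setIl P Dfin).
exists (p, q) => S DS /=; split=> [trq|PS].
  have : [set` q] (tr S) by [].
  by rewrite -qE => -[S' [DS' PS'] /tr_inj <-].
suff : [set` q] (tr S) by [].
by rewrite -qE; exists S.
Qed.

(** By independence, the sets [ind S] with S in P and the complements of the other [ind S] have the
    finite intersection property. An ultrafilter containing all of them determines P. *)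
Lemma independent_ultrafilters (T : Type) :
  exists U : set (set T) -> set_system (seq T * seq (seq T) * nat),
    [/\ forall P, UltraFilter (U P), forall P w, ~ U P [set w] & injective U].
Proof.
have [ind indP] := independent_family T.
(* The factor nat is there to make the ultrafilters free. *)
pose base (P D : set (set T)) n := [set w : seq T * seq (seq T) * nat |
  (forall S, D S -> ind S w.1 <-> P S) /\ n <= w.2].
pose G P := [set E | exists D n, finite_set D /\ base P D n `<=` E].
have GP P : ProperFilter (G P).
  split=> [[D [n [Dfin D0]]]|].
    by have [w wP] := indP D P Dfin; apply: (D0 (w, n)).
  split=> [|E E'|E E' EE' [D [n [Dfin DE]]]].
  - by exists set0, 0.
  - move=> [D [n [Dfin DE]]] [D' [n' [Dfin' DE']]].
    exists (D `|` D'), (maxn n n'); split; first by rewrite finite_setU.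
    move=> w [wP]; rewrite geq_max => /andP[nw n'w].
    by split; [apply: DE|apply: DE']; split=> // S DS; apply: wP; [left|right].
  - by exists D, n; split => //; exact: subset_trans EE'.
have /choice[U UP] : forall P, exists U, UltraFilter U /\ G P `<=` U.
  by move=> P; exact: ultraFilterLemma (GP P).
exists U; split=> [P|P w Uw|P Q UPQ]; first exact: (UP P).1.
  have [FU GU] := UP P.
  have : U P [set v | w.2 < v.2].
    by apply: GU; exists set0, w.2.+1; split => // v [].
  by move=> /(filterI Uw)/filter_ex[_ [-> /=]]; rewrite ltnn.
apply/seteqP; suff sub R R' : U R = U R' -> R `<=` R' by split; exact: sub.
move=> {P Q UPQ} UE S RS; apply: contrapT => nR'S.
have FU := (UP R).1.
have : U R [set w | ind S w.1 <-> R S].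
  by apply: (UP R).2; exists [set S], 0; split => // w [wP _]; exact: wP.
have : U R [set w | ind S w.1 <-> R' S].
  rewrite UE; apply: (UP R').2.
  by exists [set S], 0; split => // w [wP _]; exact: wP.
by move=> /filterI/[apply]/filter_ex[w [/= [+ _] [_ +]]]; tauto.
Qed.

Lemma infinite_set_type T (A : set T) : infinite_set A -> infinite_set [set: A].
Proof. by rewrite (eq_finite_set (card_setT A)). Qed.

Lemma card_le_inj T U (A : set T) (B : set U) (f : T -> U) :
  set_fun A B f -> set_inj A f -> A #<= B.
Proof.
move=> fAB finj; have /injfunPex[g] :
  exists2 f : T -> U, set_fun A B f & set_inj A f by exists f.
exact: inj_card_le.
Qed.

Lemma ultrafilter_on_image W T (U : set_system W) (A : set T) (g : W -> T) :
  UltraFilter U -> (forall w, A (g w)) ->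
  ultrafilter_on A [set B | B `<=` A /\ U (g @^-1` B)].
Proof.
move=> FU gA; apply/ultrafilter_onP.
split=> [B [] //|[_]|B C|B C [BA UB] BC CA|B BA].
- by rewrite preimage_set0; exact: filter_not_empty.
- move=> [BA UB] [CA UC]; split; first by move=> x [/BA].
  by rewrite preimage_setI; exact: filterI.
- by split => //; apply: filterS UB => w /BC.
- have [UB|UnB] := in_ultra_setVsetC (g @^-1` B) FU; [by left|right].
  by split=> [x []//|]; apply: filterS UnB => w nB; split.
Qed.

(** The upper bound holds because F is a family of subsets of A. For the lower bound, Hessenberg's
    theorem injects the index set of the independent ultrafilters into A; pushing forward along an
    injection keeps them free and distinct. *)
Lemma card_free_ultrafilters T (A : set T) : infinite_set A ->
  free_ultrafilters A #= [set: set (set A)].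
Proof.
move=> Ainf; apply/card_eqPle; split.
  pose r F := [set B : set A | F (set_val @` B)].
  apply: (@card_le_inj _ _ _ _ r) => //.
  suff sub F F' : free_ultrafilters A F -> free_ultrafilters A F' ->
      [set B : set A | F (set_val @` B)] = [set B | F' (set_val @` B)] ->
      F `<=` F'.
    move=> F F' /set_mem AF /set_mem AF' E.
    by apply/seteqP; split; apply: sub.
  move=> [FU _] [FU' _] E B FB; have BA := ultra_sub FU FB.
  have BE : B = set_val @` (set_val @^-1` B : set A).
    apply/seteqP; split=> [x Bx|_ [x Bx <-] //].
    by exists (SigSub (mem_set (BA _ Bx))).
  by move: FB; rewrite BE => FB; have : [set B : set A | F (set_val @` B)]
    (set_val @^-1` B) by []; rewrite E.
have Tinf := infinite_set_type Ainf.
have [s sinj] := infinite_seq_injection Tinf.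
have [p pinj] := infinite_pairing Tinf.
have [d dinj] := infinite_injection Tinf.
pose g (w : seq A * seq (seq A) * nat) : T :=
  set_val (p (p (s w.1.1, s (map s w.1.2)), d w.2)).
have gA w : A (g w) by exact: set_valP.
have ginj : injective g.
  move=> [[a b] n] [[a' b'] n'] /val_inj/pinj[/pinj[/sinj-> /sinj]].
  by move=> /(inj_map sinj)-> /dinj->.
have [U [UU Ufree Uinj]] := independent_ultrafilters A.
apply: (@card_le_inj _ _ _ _ (fun P => [set B | B `<=` A /\ U P (g @^-1` B)])).
  move=> P _; have FP := ultrafilter_on_image (UU P) gA; split => //.
  apply/(ultra_freeP FP) => a [_ Ua].
  have [w gwa] := @filter_ex _ _ _ _ Ua.
  apply: (Ufree P w); apply: filterS Ua => w' /= gw'a.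
  by apply: ginj; rewrite gwa gw'a.
move=> P Q _ _ E; apply: Uinj; apply/seteqP.
have gK B : g @^-1` (g @` B) = B.
  by apply/seteqP; split=> [w [w' Bw' /ginj <-] //|w Bw]; exists w.
have gBA B : g @` B `<=` A by move=> _ [w _ <-].
suff sub P' Q' : [set B | B `<=` A /\ U P' (g @^-1` B)] =
    [set B | B `<=` A /\ U Q' (g @^-1` B)] -> U P' `<=` U Q'.
  by split; apply: sub.
move=> {}E B UB.
have : [set B | B `<=` A /\ U P' (g @^-1` B)] (g @` B) by rewrite /= gK.
by rewrite E /= gK => -[].
Qed.

(** * Components and separations *)

Section Components.
Context {V : Type} (G : graph V).
Implicit Types (X Y C D : set V) (CC : set (set V)).

Lemma connected_in_closed C (P : set V) u : connected_in G C -> C u -> P u ->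
  (forall x y, C x -> C y -> adj G x y -> P x -> P y) -> C `<=` P.
Proof.
move=> [_ Cuv] Cu Pu PP v Cv; have uv := Cuv _ _ Cu Cv.
elim: uv Pu => {u v Cu Cv} [x y [Cx Cy xy]|//|x y z _ xy _ yz /xy/yz //].
exact: PP.
Qed.

Lemma connected_in_bigcup (F : set (set V)) v :
  F !=set0 -> (forall C, F C -> connected_in G C /\ C v) ->
  connected_in G (\bigcup_(C in F) C).
Proof.
move=> [C0 FC0] FP; split; first by exists v, C0 => //; exact: (FP _ FC0).2.
have lift C x y : F C -> C x -> C y ->
  clos_refl_trans V (fun a b => [/\ (\bigcup_(C in F) C) a,
    (\bigcup_(C in F) C) b & adj G a b]) x y.
  move=> FC Cx Cy; have [[_ /(_ _ _ Cx Cy) xy] _] := FP _ FC.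
  elim: xy => {x y Cx Cy} [x y [Cx Cy xy]|x|x y z _ xy _ yz].
  - by apply: rt_step; split => //; exists C.
  - exact: rt_refl.
  - exact: rt_trans xy yz.
move=> x y [C FC Cx] [D FD Dy]; apply: (@rt_trans _ _ _ v).
  exact: lift FC Cx (FP _ FC).2.
exact: lift FD (FP _ FD).2 Dy.
Qed.

Lemma connected_inU C D v : connected_in G C -> connected_in G D ->
  C v -> D v -> connected_in G (C `|` D).
Proof.
move=> Cc Dc Cv Dv; rewrite (_ : _ `|` _ = \bigcup_(E in [set C; D]) E).
  apply: (@connected_in_bigcup _ v); first by exists C; left.
  by move=> E [->|->].
apply/seteqP; split=> [x [Cx|Dx]|x [E [->|->]]]; [| |by left|by right].
  by exists C => //; left.
by exists D => //; right.
Qed.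

Lemma connected_in1 v : connected_in G [set v].
Proof. by split=> [|x y -> ->]; [exists v|exact: rt_refl]. Qed.

Lemma connected_in2 u v : adj G u v -> connected_in G [set u; v].
Proof.
move=> uv; split=> [|x y [->|->] [->|->]]; first by exists u; left.
- exact: rt_refl.
- by apply: rt_step; split => //; [left|right].
- by apply: rt_step; split; [right|left|exact: adj_sym].
- exact: rt_refl.
Qed.

Lemma components_absorb X C D v : components G X C -> connected_in G D ->
  D `<=` ~` X -> C v -> D v -> D `<=` C.
Proof.
move=> [CX Cc Cmax] Dc DX Cv Dv.
rewrite -(Cmax (C `|` D)); first by move=> x; right.
- by move=> x [/CX|/DX].
- exact: connected_inU Cc Dc Cv Dv.
- by move=> x; left.
Qed.

Lemma components_eq X C D v : components G X C -> components G X D ->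
  C v -> D v -> C = D.
Proof.
move=> XC XD Cv Dv; have [CX Cc _] := XC; have [DX Dc _] := XD.
apply/seteqP; split; first exact: (components_absorb XD Cc CX Dv Cv).
exact: (components_absorb XC Dc DX Cv Dv).
Qed.

Lemma components_ex X v : ~ X v -> exists2 C, components G X C & C v.
Proof.
move=> nXv; pose F := [set C | [/\ connected_in G C, C `<=` ~` X & C v]].
have F1 : F [set v] by split=> //; [exact: connected_in1|move=> x ->].
exists (\bigcup_(C in F) C); last by exists [set v].
split.
- by move=> x [C [_ CX _]] /CX.
- by apply: (@connected_in_bigcup F v); [exists [set v]|move=> C []].
- move=> D DX Dc FD; apply/seteqP; split=> // x Dx; exists D => //; split=> //.
  by apply: FD; exists [set v].
Qed.

Lemma components_step X C u v : components G X C -> C u -> adj G u v ->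
  ~ X v -> C v.
Proof.
move=> XC Cu uv nXv; have [CX _ _] := XC.
apply: (components_absorb XC (connected_in2 uv) _ Cu); [|by left|by right].
by move=> x [->|->] //; exact: CX.
Qed.

Lemma components_nonempty X C : components G X C -> C !=set0.
Proof. by move=> [_ []]. Qed.

Lemma neighbourhood_sub X C : components G X C -> neighbourhood G C `<=` X.
Proof.
move=> XC v [nCv [u Cu uv]]; apply: contrapT => nXv.
by apply: nCv; exact: components_step XC Cu uv nXv.
Qed.

(** A walk can leave C only through its neighbourhood Y, so C does not grow when the vertices of X -
    Y are put back. *)
Lemma components_atS X Y C : Y `<=` X -> components_at G X Y C ->
  components_at G Y Y C.
Proof.
move=> YX [[CX Cc Cmax] NC]; split=> //; split=> //.
  by move=> x Cx /YX; exact: CX.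
move=> D DY Dc CD; apply/seteqP; split=> //.
have [[v Cv] _] := Cc; apply: (connected_in_closed Dc (CD _ Cv) Cv).
move=> x y Dx Dy xy Cx; apply: contrapT => nCy; apply: (DY _ Dy).
by rewrite -NC; split => //; exists x.
Qed.

(** Every vertex of C lies strictly on one side of s, and no edge joins the two strict sides. *)
Lemma connected_in_separation s C : separations G s -> connected_in G C ->
  C `&` (s.1 `&` s.2) = set0 -> C `<=` s.1 `\` s.2 \/ C `<=` s.2 `\` s.1.
Proof.
move=> [sT _ sadj] Cc C0.
have side x : C x -> (s.1 `\` s.2) x \/ (s.2 `\` s.1) x.
  move=> Cx; have [s1x|s2x] : (s.1 `|` s.2) x by rewrite sT.
    by left; split=> // s2x; have : set0 x by rewrite -C0.
  by right; split=> // s1x; have : set0 x by rewrite -C0.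
have [[v Cv] _] := Cc; have [sv|sv] := side _ Cv; [left|right];
    apply: (connected_in_closed Cc Cv sv) => x y Cx Cy xy sx.
  by have [//|sy] := side _ Cy; have := sadj _ _ sx sy.
by have [sy|//] := side _ Cy; have := sadj _ _ sy sx; case; exact: adj_sym.
Qed.

Lemma sep_toD X CC : CC `<=` components G X ->
  (sep_to X CC).2 `\` (sep_to X CC).1 = \bigcup_(C in CC) C.
Proof.
move=> CX; rewrite /= setDE setCK setIUl setIid; apply/setUidPr.
by move=> x [].
Qed.

Lemma sep_toI X CC : CC `<=` components G X ->
  (sep_to X CC).1 `&` (sep_to X CC).2 = X.
Proof.
move=> CX; rewrite /= setIUr setICl setU0.
apply/setIidPr => x Xx [C /CX[+ _ _]]; by move=> /[apply].
Qed.

Lemma sep_to_separation X CC : finite_set X -> CC `<=` components G X ->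
  separations G (sep_to X CC).
Proof.
move=> Xfin CX; split; last 1 first.
- move=> u v; rewrite (sep_toD CX) => -[nu nXu] [C CCC Cv] uv; apply: nu.
  exists C => //; apply: (components_step (CX _ CCC) Cv (adj_sym uv)) => Xu.
  by apply: nXu; left.
- by rewrite /= setUCA setUCl setUT.
- by rewrite sep_toI.
Qed.

Lemma bigcup_componentsD X CC : CC `<=` components G X ->
  \bigcup_(C in components G X `\` CC) C = ~` (X `|` \bigcup_(C in CC) C).
Proof.
move=> CX; apply/seteqP; split=> [x [C [XC nCC] Cx] [Xx|[D DD Dx]]|x nx].
- by have [/(_ _ Cx)] := XC.
- by apply: nCC; rewrite (components_eq XC (CX _ DD) Cx Dx).
- have [|C XC Cx] := @components_ex X x; first by move=> Xx; apply: nx; left.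
  by exists C => //; split => // CCC; apply: nx; right; exists C.
Qed.

(** Lets the choice of an orientation become the ultrafilter dichotomy between a set of components
    and its complement. *)
Lemma sep_to_compl X CC : CC `<=` components G X ->
  sep_to X (components G X `\` CC) = sep_inv (sep_to X CC).
Proof.
move=> CX; rewrite /sep_to /sep_inv bigcup_componentsD //= setCK; congr pair.
rewrite setCU setUIr setUCr setTI; apply/setUidPr => x Xx [C /CX[+ _ _]].
by move=> /[apply].
Qed.

End Components.

(** * Tangles *)

Section TangleFilters.
Context {V : Type} (G : graph V).
Implicit Types (X Y C D : set V) (CC DD : set (set V)).
Implicit Types (s t : set V * set V).

Lemma sep_invK s : sep_inv (sep_inv s) = s.
Proof. by case: s. Qed.

Lemma separations_inv s : separations G s -> separations G (sep_inv s).
Proof.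
case: s => A B [/= AB fin nadj]; split=> /=; rewrite 1?setUC 1?setIC //.
by move=> u v Bu Av uv; apply: (nadj v u) => //; exact: adj_sym.
Qed.

(** Distinct components are disjoint, so disjoint sets of components give small sides that meet only
    in X. *)
Lemma star_sep_to X (P : set (set (set V))) : finite_set X ->
  (forall CC, P CC -> CC `<=` components G X) ->
  (forall CC DD, P CC -> P DD -> CC !=set0 -> CC = DD \/ CC `&` DD = set0) ->
  star G [set sep_inv (sep_to X CC) | CC in P].
Proof.
move=> Xfin PX Pdisj; split.
  move=> _ [CC PC <-]; apply: separations_inv.
  exact: sep_to_separation Xfin (PX _ PC).
have le CC DD : P CC -> P DD -> CC <> DD ->
    X `|` \bigcup_(C in CC) C `<=` ~` \bigcup_(D in DD) D.
  move=> PC PD CD x xC [D DD_D Dx]; have XD := PX _ PD _ DD_D.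
  case: xC => [Xx|[C CCC Cx]]; first by have [/(_ _ Dx)] := XD.
  have DC : D = C by apply: components_eq XD (PX _ PC _ CCC) Dx Cx.
  have [|//|] := Pdisj CC DD PC PD; first by exists C.
  by move=> E; have : set0 C by rewrite -E; split => //; rewrite -DC.
move=> _ _ [CC PC <-] [DD PD <-] CD; rewrite sep_invK.
have {}CD : CC <> DD by move=> E; apply: CD; rewrite E.
split=> /= [|x xD xC]; first exact: le.
by apply: (le DD CC PD PC _ x xD xC) => E; apply: CD.
Qed.

(** * The ultrafilters U(tau, X) of a tangle *)

Section OneTangle.
Context {tau : set (set V * set V)}.
Hypothesis tauP : aleph0_tangle G tau.

Lemma tangle_sep s : tau s -> separations G s.
Proof. by have [+ _ _ _] := tauP; exact. Qed.

Lemma tangle_or s : separations G s -> tau s \/ tau (sep_inv s).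
Proof.
have [_ tau1 _ _] := tauP.
by move=> /tau1[t [[tt [E|E]] _]]; rewrite -E; [left|right].
Qed.

Lemma tangle_infinite s : tau s -> infinite_set s.2.
Proof.
move=> ts s2; have [_ _ _ /(_ [set s])] := tauP; apply.
- by split=> [t ->|t t' -> ->] //; exact: tangle_sep.
- exact: finite_set1.
- by rewrite /interior bigcap_set1.
- by move=> t ->.
Qed.

Lemma tangle_star2 s t : tau s -> tau t -> sep_le s (sep_inv t) ->
  infinite_set (s.2 `&` t.2).
Proof.
move=> ts tt [st1 st2] fin; have [_ _ _ /(_ [set s; t])] := tauP; apply.
- split=> [r [->|->]|r r' [->|->] [->|->]] //; exact: tangle_sep.
- exact: finite_set2.
- rewrite /interior; apply: sub_finite_set fin => x xst.
  by split; apply: xst; [left|right].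
- by move=> r [->|->].
Qed.

Lemma tangle_inv s : tau s -> ~ tau (sep_inv s).
Proof.
move=> ts tis; have [_ + _] := tangle_sep ts.
rewrite setIC; apply: (tangle_star2 ts tis).
by rewrite sep_invK; split.
Qed.

(** Otherwise tau contains the inverse of t, which violates consistency with s unless the two
    coincide; in that case the big side of s is finite. *)
Lemma tangle_le s t : tau s -> separations G t -> sep_le t s -> tau t.
Proof.
move=> ts sept [ts1 st2]; have [//|tit] := tangle_or sept; exfalso.
have [_ _ cons _] := tauP.
have [E|sit] := pselect (s = sep_inv t).
  have [_ + _] := sept; rewrite (_ : _ `&` _ = s.2).
    exact: tangle_infinite.
  by rewrite E /=; apply/setIidPl; move: ts1; rewrite E.
apply: (cons _ _ ts tit sit); split; first by [].
by move=> E; apply: (tangle_inv ts); rewrite E.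
Qed.

Lemma tangle_filterC X CC : finite_set X -> CC `<=` components G X ->
  tangle_filter G tau X (components G X `\` CC) <-> ~ tangle_filter G tau X CC.
Proof.
move=> Xfin CX; have sX := sep_to_separation Xfin CX.
rewrite /tangle_filter /= sep_to_compl //; split=> [[_ tis] [_ ts]|nt].
  exact: tangle_inv tis.
split; first by move=> C [].
by have [ts|//] := tangle_or sX; exfalso; apply: nt.
Qed.

Lemma tangle_filterS X CC DD : finite_set X -> tangle_filter G tau X CC ->
  CC `<=` DD -> DD `<=` components G X -> tangle_filter G tau X DD.
Proof.
move=> Xfin [CX tC] CD DX; split=> //.
apply: (tangle_le tC); first exact: sep_to_separation.
split=> /=; first by apply: subsetC; exact: bigcup_subset.
by apply: setUS; exact: bigcup_subset.
Qed.

(** The substance is closure under intersection. If it fails for CC and DD, the partition of the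
    components into the complement of CC, CC /\ DD and CC - DD yields three separations in tau that
    form a star with interior in X. *)
Lemma tangle_filter_ultra X : finite_set X ->
  ultrafilter_on (components G X) (tangle_filter G tau X).
Proof.
move=> Xfin; apply/ultrafilter_onP.
have UC := tangle_filterC Xfin; have US := @tangle_filterS X.
split=> [CC []//|[_]|CC DD UCC UDD|CC DD UCC|CC CX].
- by move/tangle_infinite; rewrite /= bigcup_set0 setU0.
- have [CX tC] := UCC; have [DX tD] := UDD.
  apply: contrapT => nUI.
  have CDX : CC `&` DD `<=` components G X by move=> C [/CX].
  have CX1 : CC `\` DD `<=` components G X by move=> C [/CX].
  have CX0 : components G X `\` CC `<=` components G X by move=> C [].
  have [_ t2] := (UC _ CDX).2 nUI; rewrite sep_to_compl // in t2.
  have [_ t3] : tangle_filter G tau X (components G X `\` (CC `\` DD)).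
    by apply: (US _ _ Xfin UDD) => [C DC|C []//]; split; [exact: DX|case].
  rewrite sep_to_compl // in t3.
  pose P := [set components G X `\` CC; CC `&` DD; CC `\` DD].
  have [_ _ _ /(_ [set sep_inv (sep_to X P') | P' in P])] := tauP; apply.
  + apply: star_sep_to => // [_ [[->|->]|->] //|].
    move=> _ _ [[->|->]|->] [[->|->]|->] _;
      by [left|right; apply/seteqP; split=> // C [[? ?] []]].
  + by apply: finite_image; exact: finite_set3.
  + apply: sub_finite_set Xfin => x xs; apply: contrapT => nXx.
    have [C XC Cx] := components_ex G nXx.
    have xP P' : P P' -> ~ P' C.
      by move=> PP' P'C; case: (xs _ (imageP _ PP')); exists C.
    have [CCC|nCCC] := pselect (CC C); last first.
      by apply: (xP (components G X `\` CC)) => //; left; left.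
    have [DDC|nDDC] := pselect (DD C).
      by apply: (xP (CC `&` DD)) => //; left; right.
    by apply: (xP (CC `\` DD)) => //; right.
  + move=> _ [P' [[->|->]|->] <-] //.
    by rewrite (sep_to_compl CX) sep_invK.
- exact: US.
- by have [|/UC-/(_ CX)] := pselect (tangle_filter G tau X CC); [left|right].
Qed.

(** Otherwise [sep_to X CC] and the inverse of [sep_to Y CC] form a star in tau with interior in
    X. *)
Lemma tangle_filter_anti X Y CC : finite_set X -> Y `<=` X ->
  CC `<=` components G Y -> tangle_filter G tau X CC ->
  tangle_filter G tau Y CC.
Proof.
move=> Xfin YX CY [CX tX]; split=> //.
have Yfin := sub_finite_set YX Xfin.
have [//|tY] := tangle_or (sep_to_separation Yfin CY); exfalso.
apply: (tangle_star2 tX tY).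
  by rewrite sep_invK; split=> //; exact: setSU.
by apply: sub_finite_set Xfin => x [[Xx|Wx] nWx].
Qed.

Lemma tangle_filter_mono X Y CC : finite_set X -> Y `<=` X ->
  CC `<=` components G X -> tangle_filter G tau Y CC ->
  tangle_filter G tau X CC.
Proof.
move=> Xfin YX CX [CY tY]; split=> //; apply: (tangle_le tY).
  exact: sep_to_separation.
by split=> //=; exact: setSU.
Qed.

(** For each of the finitely many x in X the ultrafilter decides whether almost all components have
    x as a neighbour. Let Y be the set of those x that are chosen: almost all components have
    neighbourhood exactly Y, and they are components of G - Y too. *)
Lemma tangle_concentrate X : free_sets G tau X ->
  exists2 Y, free_sets G tau Y & tangle_filter G tau Y (components_at G Y Y).
Proof.
move=> [Xfin Xfree]; have XU := tangle_filter_ultra Xfin.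
pose N x := [set C | components G X C /\ neighbourhood G C x].
pose Y := [set x | X x /\ tangle_filter G tau X (N x)].
have YX : Y `<=` X by move=> x [].
have Yfin := sub_finite_set YX Xfin; have YU := tangle_filter_ultra Yfin.
have UY : tangle_filter G tau X (components_at G X Y).
  have : forall x, X x -> tangle_filter G tau X
      [set C | components G X C /\ (neighbourhood G C x <-> Y x)].
    move=> x Xx; have NX : N x `<=` components G X by move=> C [].
    have [UN|UnN] := ultraVD XU NX.
      by apply: (ultraS XU UN) => C [] //; split.
    apply: (ultraS XU UnN) => [C [XC nN]|C []//]; split=> //.
    split=> [NC|[_ UN]]; first by case: nN.
    by have := ultraI XU UN UnN; rewrite setDIK => /(ultra_set0 XU).
  move=> /(ultra_bigcap XU Xfin) UI.
  apply: (ultraS XU UI) => [C [XC NC]|C []//].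
  split=> //; apply/seteqP; split=> x.
    by move=> NCx; apply/(NC x _).2 => //; exact: neighbourhood_sub XC _ NCx.
  by move=> Yx; apply/(NC x _).2 => //; exact: YX.
have XY C : components_at G X Y C -> components_at G Y Y C.
  exact: components_atS.
have UYY : tangle_filter G tau Y (components_at G X Y).
  by apply: tangle_filter_anti UY => // C /XY[].
exists Y; last by apply: (ultraS YU UYY) => // C [].
split=> //; apply/(ultra_freeP YU) => D UD.
(* A singleton in U(tau, Y) consists of a component of G - X as well, so it would also lie in the
   free ultrafilter U(tau, X). *)
have [_ [-> XYD]] := ultraN0 YU (ultraI YU UD UYY).
move/(ultra_freeP XU): Xfree => /(_ D); apply.
by apply: tangle_filter_mono UD => // _ ->; case: XYD.
Qed.

End OneTangle.

(** * From free ultrafilters to tangles *)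

Definition tangle_of X (F : set (set (set V))) : set (set V * set V) :=
  [set s | separations G s /\
    F [set C | components_at G X X C /\ C `<=` s.2 `\` s.1]].

Definition trace (tau : set (set V * set V)) X : set (set (set V)) :=
  tangle_filter G tau X `&` [set CC | CC `<=` components_at G X X].

Section TangleOf.
Context {X : set V} {F : set (set (set V))}.
Hypothesis Xfin : finite_set X.
Hypothesis Ffree : free_ultrafilters (components_at G X X) F.
Let K := components_at G X X.
Let FU : ultrafilter_on K F. Proof. by case: Ffree. Qed.

(** Each vertex of Z lies in at most one member of K, and a free ultrafilter ignores finite sets. *)
Lemma ultra_avoid (Z : set V) : finite_set Z ->
  F [set C | K C /\ C `&` Z = set0].
Proof.
move=> Zfin; set E := [set C | _].
have [|//|] := @ultraVD _ _ _ FU E; first by move=> C [].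
rewrite (_ : K `\` E = \bigcup_(v in Z) [set C | K C /\ C v]).
  move=> /(ultra_bigcup FU Zfin)[v Zv] Fv; exfalso.
  apply: (ultra_free_infinite FU (Ffree.2) Fv).
  have [C [KC Cv]] := ultraN0 FU Fv.
  apply: sub_finite_set (finite_set1 C) => D [KD Dv].
  exact: components_eq KD.1 KC.1 Dv Cv.
apply/seteqP; split=> [C [KC nE]|C [v Zv [KC Cv]]].
  have [v [Cv Zv]] : C `&` Z !=set0.
    by apply/set0P/eqP => CZ; apply: nE.
  by exists v.
split=> // -[_ CZ]; have : set0 v by rewrite -CZ.
by [].
Qed.

Lemma tangle_of_or s : separations G s ->
  tangle_of X F s \/ tangle_of X F (sep_inv s).
Proof.
move=> sep; have [_ fin _] := sep.
have : F ([set C | K C /\ C `<=` s.2 `\` s.1] `|`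
          [set C | K C /\ C `<=` s.1 `\` s.2]).
  apply: (ultraS FU (ultra_avoid fin)) => [C [KC C0]|C [] []//].
  have [_ Cc _] := KC.1.
  by have [] := connected_in_separation sep Cc C0; [right|left].
move=> /(ultraU FU)[Fs|Fs]; [left|right]; split=> //.
exact: separations_inv.
Qed.

(** Finite intersections of members of F are infinite. Uniqueness of the orientation, consistency
    and the star axiom all rest on this. *)
Lemma tangle_of_common (sigma : set (set V * set V)) : finite_set sigma ->
  sigma `<=` tangle_of X F ->
  exists P, [/\ infinite_set P, P `<=` K &
    forall C s, P C -> sigma s -> C `<=` s.2 `\` s.1].
Proof.
move=> fin sF; have /(ultra_bigcap FU fin) FI : forall s, sigma s ->
  F [set C | K C /\ C `<=` s.2 `\` s.1] by move=> s /sF[].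
exists (K `&` \bigcap_(s in sigma) [set C | K C /\ C `<=` s.2 `\` s.1]); split.
- exact: (ultra_free_infinite FU (Ffree.2) FI).
- by move=> C [].
- by move=> C s [_ CI] /CI[].
Qed.

Lemma tangle_of_sep_to Y CC : finite_set Y -> CC `<=` components G Y ->
  tangle_of X F (sep_to Y CC) <-> F [set C | K C /\ C `<=` \bigcup_(D in CC) D].
Proof.
move=> Yfin CY; rewrite -(sep_toD CY); split=> [[]//|FC]; split=> //.
exact: sep_to_separation.
Qed.

Lemma tangle_of_tangle : aleph0_tangle G (tangle_of X F).
Proof.
have common2 s t : tangle_of X F s -> tangle_of X F t ->
    exists v, [/\ s.2 v, ~ s.1 v, t.2 v & ~ t.1 v].
  move=> ts tt; have [r [->|->]//|P [Pinf PK PC]] :=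
      tangle_of_common (finite_set2 s t).
  have [C CP] := infinite_setN0 Pinf.
  have [v Cv] := components_nonempty (PK _ CP).1.
  have [s2 ns1] := PC _ s CP (or_introl erefl) v Cv.
  by have [t2 nt1] := PC _ t CP (or_intror erefl) v Cv; exists v.
split=> [s []//|s seps|s t ts tt _ [[st1 st2] _]|sigma _ fin ifin sF].
- have [ts|ts] := tangle_of_or seps; [exists s|exists (sep_inv s)]; split.
  + by split=> //; left.
  + move=> t [tt [->//|tE]]; rewrite tE in tt.
    by have [v []] := common2 _ _ ts tt.
  + by split=> //; right.
  + move=> t [tt [tE|->//]]; rewrite tE in tt.
    by have [v []] := common2 _ _ ts tt.
- by have [v [s2 ns1 t2 nt1]] := common2 _ _ ts tt; apply: nt1; apply: st1.
- have [P [Pinf PK PC]] := tangle_of_common fin sF.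
  (* Picking a vertex in each member of [P] injects this infinite set into the interior. *)
  have /choice[f fP] : forall C, exists v, P C -> C v.
    move=> C; have [PC'|nPC] := pselect (P C).
      by have [v Cv] := components_nonempty (PK _ PC').1; exists v.
    have [C0 PC0] := infinite_setN0 Pinf.
    by have [v _] := components_nonempty (PK _ PC0).1; exists v.
  apply: Pinf; apply: (card_le_finite _ ifin); apply: (@card_le_inj _ _ _ _ f).
    by move=> C CP s ss; have [] := PC C s CP ss _ (fP _ CP).
  move=> C D /set_mem CP /set_mem DP fCD.
  apply: (components_eq (PK _ CP).1 (PK _ DP).1 (fP _ CP)).
  by rewrite fCD; exact: fP.
Qed.

Lemma tangle_filter_of CC : CC `<=` components G X ->
  tangle_filter G (tangle_of X F) X CC <-> F (CC `&` K).
Proof.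
move=> CX; rewrite /tangle_filter /= tangle_of_sep_to //.
rewrite (_ : CC `&` K = [set C | K C /\ C `<=` \bigcup_(D in CC) D]).
  by split=> [[]|].
apply/seteqP; split=> [C [CCC KC]|C [KC CW]].
  by split=> // v Cv; exists C.
split=> //; have [v Cv] := components_nonempty KC.1.
have [D CD Dv] := CW _ Cv.
by rewrite (components_eq KC.1 (CX _ CD) Cv Dv).
Qed.

Lemma trace_tangle_of : trace (tangle_of X F) X = F.
Proof.
apply/seteqP; split=> CC.
  move=> [UC CK]; have [CX _] := UC.
  by have := (tangle_filter_of CX).1 UC; rewrite (setIidPl _ _).2.
move=> FC; have CK := ultra_sub FU FC.
have CX : CC `<=` components G X by move=> C /CK[].
by split=> //; apply/(tangle_filter_of CX); rewrite (setIidPl _ _).2.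
Qed.

Lemma free_set_tangle_of : free_sets G (tangle_of X F) X.
Proof.
split=> //; have XU := tangle_filter_ultra tangle_of_tangle Xfin.
apply/(ultra_freeP XU) => C UC; have [CX _] := UC.
have := ultra_free_infinite FU (Ffree.2) ((tangle_filter_of CX).1 UC); apply.
exact/finite_setIl/finite_set1.
Qed.

Lemma free_sets_tangle_of_sub Y : free_sets G (tangle_of X F) Y -> X `<=` Y.
Proof.
move=> [Yfin Yfree] x Xx; apply: contrapT => nYx.
have YU := tangle_filter_ultra tangle_of_tangle Yfin.
have [D YD Dx] := components_ex G nYx.
move/(ultra_freeP YU): Yfree => /(_ D); apply.
have DY : [set D] `<=` components G Y by move=> _ ->.
split=> //; apply/(tangle_of_sep_to Yfin DY); rewrite bigcup_set1.
apply: (ultraS FU (ultra_avoid Yfin)) => [C [KC CY]|C []//]; split=> //.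
have [_ [u Cu ux]] : neighbourhood G C x by rewrite KC.2.
have CnY : C `<=` ~` Y by move=> v Cv Yv; have : set0 v by rewrite -CY.
have Du : D u by apply: components_step YD Dx (adj_sym ux) (CnY _ Cu).
by have [[_ Cc _] _] := KC; apply: components_absorb YD Cc CnY Du Cu.
Qed.

Lemma least_free_set_tangle_of : least_free_set G (tangle_of X F) = X.
Proof.
rewrite /least_free_set.
have [Yfree Yleast] := xgetI set0
  (conj free_set_tangle_of free_sets_tangle_of_sub :
   [set Y | free_sets G (tangle_of X F) Y /\
       forall Z, free_sets G (tangle_of X F) Z -> Y `<=` Z] X).
apply/seteqP; split; first exact: Yleast free_set_tangle_of.
exact: free_sets_tangle_of_sub.
Qed.

Lemma ultrafilter_tangle_of : ultrafilter_tangles G (tangle_of X F).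
Proof.
by split; [exact: tangle_of_tangle|exists X; exact: free_set_tangle_of].
Qed.

End TangleOf.

(** * Recovering a tangle from its trace *)

Lemma trace_free tau X : aleph0_tangle G tau -> free_sets G tau X ->
  tangle_filter G tau X (components_at G X X) ->
  free_ultrafilters (components_at G X X) (trace tau X).
Proof.
move=> tauP [Xfin Xfree] UK; have XU := tangle_filter_ultra tauP Xfin.
have KU := ultrafilter_on_restrict XU UK; split=> //.
apply/(ultra_freeP KU) => C [UC _].
by move/(ultra_freeP XU): Xfree => /(_ C).
Qed.

(** One inclusion suffices, since [tangle_of] orients every separation and tau never contains both
    orientations. If tau contains the inverse of some s in [tangle_of], the corner [r] lies below
    that inverse, hence in tau, and forms with [sep_to X CC] a star with interior in X. *)
Lemma tangle_of_trace tau X : aleph0_tangle G tau -> free_sets G tau X ->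
  tangle_filter G tau X (components_at G X X) ->
  tangle_of X (trace tau X) = tau.
Proof.
move=> tauP Xfree UK; have KF := trace_free tauP Xfree UK.
have Xfin := Xfree.1.
have sub : tangle_of X (trace tau X) `<=` tau.
  move=> s [seps [[CX tW] _]]; have [//|tis] := tangle_or tauP seps; exfalso.
  set CC := [set C | _] in CX tW; pose W := \bigcup_(C in CC) C.
  have WS : W `<=` s.2 `\` s.1 by move=> v [C [_ CS] /CS].
  have rfin : finite_set ((X `|` W) `&` ~` W).
    by apply: sub_finite_set Xfin => x [[Xx|Wx] nWx].
  (* The corner of (s.2, s.1) and (X + W, V - W). *)
  pose r := (W `|` (X `&` s.2), ~` W).
  have rW : r.1 `<=` X `|` W by move=> x [Wx|[Xx _]]; [right|left].
  have sepr : separations G r.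
    split=> /=.
    - by rewrite setUAC setUCr setTU.
    - by apply: sub_finite_set rfin; exact: setSI.
    (* An edge leaving [W] ends in X. Its end v avoids [s.2], because X /\ s.2 is part of [r.1], so
       the edge would cross s. *)
    - move=> u v [_ /contrapT Wu] [nWv nv] uv; have [_ _ sadj] := seps.
      have [C CCC Cu] := Wu.
      have Xv : X v.
        apply: contrapT => nXv; apply: nWv; exists C => //.
        exact: components_step (CX _ CCC) Cu uv nXv.
      apply: (sadj v u); [|exact: WS|exact: adj_sym].
      have ns2 : ~ s.2 v by move=> s2v; apply: nv; right.
      have [sT _ _] := seps; split=> //.
      by have [] : (s.1 `|` s.2) v by rewrite sT.
  have tr : tau r.
    apply: (tangle_le tauP tis sepr); split=> x /=.
      by move=> [/WS[]|[]].
    by move=> s1x /WS[].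
  by apply: (tangle_star2 tauP tr tW); [split|rewrite setIC].
apply/seteqP; split=> // s ts.
have [//|/sub tis] := tangle_of_or KF (tangle_sep tauP ts).
by have := tangle_inv tauP ts.
Qed.

Lemma crit_of_free_set tau X : aleph0_tangle G tau -> free_sets G tau X ->
  tangle_filter G tau X (components_at G X X) -> crit G X.
Proof.
move=> tauP [Xfin Xfree] UK; split=> //.
exact: (ultra_free_infinite (tangle_filter_ultra tauP Xfin) Xfree UK).
Qed.

(** Concentration gives a free set X for which tau is the tangle of its trace; the least free set of
    such a tangle is already known to be X. *)
Lemma ultrafilter_tangleP tau : ultrafilter_tangles G tau ->
  let X := least_free_set G tau in
  [/\ crit G X, free_ultrafilters (components_at G X X) (trace tau X) &
    tangle_of X (trace tau X) = tau].
Proof.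
move=> [tauP [X0 /(tangle_concentrate tauP)[X Xfree UK]]].
have KF := trace_free tauP Xfree UK; have tauE := tangle_of_trace tauP Xfree UK.
have -> : least_free_set G tau = X.
  by rewrite -tauE; exact: least_free_set_tangle_of Xfree.1 KF.
by split=> //; exact: crit_of_free_set UK.
Qed.

Lemma bij_trace X : crit G X ->
  set_bij (tangles_at G X) (free_ultrafilters (components_at G X X))
    (trace^~ X).
Proof.
move=> [Xfin Xinf]; split=> [tau [/ultrafilter_tangleP[_ KF _] <-] //||F KF].
  move=> tau tau' /set_mem[/ultrafilter_tangleP[_ _ E] X1].
  move=> /set_mem[/ultrafilter_tangleP[_ _ E'] X2] /= trE.
  by rewrite -E -E' X1 X2 trE.
exists (tangle_of X F); last exact: trace_tangle_of.
by split; [exact: ultrafilter_tangle_of|exact: least_free_set_tangle_of].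
Qed.

Lemma card_tangles_at X : crit G X ->
  tangles_at G X #= [set: set (set (components_at G X X))].
Proof.
move=> critX; have [_ Kinf] := critX.
apply: card_eq_trans (card_free_ultrafilters Kinf).
apply/card_set_bijP; exists (trace^~ X); exact: bij_trace.
Qed.

Lemma tangles_at_nonempty X : crit G X -> tangles_at G X !=set0.
Proof.
move=> /card_tangles_at E; apply/set0P/eqP => E0.
move: E; rewrite E0 card_eq_sym card_eq0 => /eqP E.
have : [set: set (set (components_at G X X))] set0 by [].
by rewrite E.
Qed.

End TangleFilters.

(** * Counting critical sets and the final assembly *)

Lemma infinite_finite_sets_card T : infinite_set [set: T] ->
  [set X : set T | finite_set X] #<= [set: T].
Proof.
elim/Pchoice: T => T Tinf; have [s sinj] := infinite_seq_injection Tinf.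
have /choice[l lP] : forall X : set T, exists l : seq T,
    finite_set X -> X = [set` l].
  move=> X; have [/finite_seqP[l XE]|nfin] := pselect (finite_set X).
    by exists l.
  by exists [::].
apply: (@card_le_inj _ _ _ _ (s \o l)) => // X Y /set_mem Xfin /set_mem Yfin.
by move=> /sinj lE; rewrite (lP _ Xfin) (lP _ Yfin) lE.
Qed.

Lemma image_injective T U (f : T -> U) : injective f ->
  injective (fun A : set T => f @` A).
Proof.
move=> finj; suff sub A B : f @` A = f @` B -> A `<=` B.
  by move=> A B AB; apply/seteqP; split; apply: sub.
by move=> AB x Ax; have [y By /finj <- //] : (f @` B) (f x)
  by rewrite -AB; exists x.
Qed.

Theorem theorem4p10 (V : Type) (G : graph V) :
  [/\ exists f : set (set (set V * set V)) -> set V,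
        (forall tau, ultrafilter_tangles G tau ->
           f (tangle_class G tau) = least_free_set G tau) /\
        set_bij (tangle_quotient G) (crit G) f,
      forall X, crit G X ->
        [/\ set_bij (tangles_at G X) (free_ultrafilters (components_at G X X))
              (fun tau => tangle_filter G tau X `&`
                          [set CC | CC `<=` components_at G X X]),
            [set: nat] #<= components_at G X X &
            tangles_at G X #= [set: set (set (components_at G X X))]],
      crit G #<= [set: V] &
      crit G `*` [set: set (set nat)] #<= ultrafilter_tangles G].
Proof.
split.
(* Well defined because each ultrafilter tangle belongs to its own class, so equal classes have the
   same least free set. *)
- have /choice[f fP] : forall c, exists X, forall tau,
      ultrafilter_tangles G tau -> tangle_class G tau = c ->
      X = least_free_set G tau.
    move=> c; have [[tau [tauP tauc]]|nc] := pselect (exists tau,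
        ultrafilter_tangles G tau /\ tangle_class G tau = c); last first.
      by exists set0 => tau tauP tauc; exfalso; apply: nc; exists tau.
    exists (least_free_set G tau) => tau' tau'P tau'c.
    have [_ //] : tangle_class G tau tau' by rewrite tauc -tau'c; split.
  have fE tau : ultrafilter_tangles G tau ->
    f (tangle_class G tau) = least_free_set G tau by move=> tauP; exact: fP.
  exists f; split => //; split.
  + move=> _ [tau tauP <-]; rewrite fE //.
    by have [] := ultrafilter_tangleP tauP.
  + move=> _ _ /set_mem[tau tauP <-] /set_mem[tau' tau'P <-].
    rewrite !fE // => E; apply/seteqP.
    by split=> sigma [sigmaP sE]; split=> //; rewrite /tangle_equiv E in sE *.
  + move=> X /tangles_at_nonempty[tau [tauP tauX]].
    by exists (tangle_class G tau); [exists tau|rewrite fE].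
- move=> X critX; split; first exact: bij_trace.
    by apply/infiniteP; have [] := critX.
  exact: card_tangles_at.
- have [Vfin|Vinf] := pselect (finite_set [set: V]); last first.
    apply: card_le_trans (infinite_finite_sets_card Vinf).
    by apply: subset_card_le => X [].
  (* A critical set carries a tangle, but over a finite V neither orientation of [(set0, setT)] has
     an infinite big side. *)
  suff -> : crit G = set0 by exact: card_ge0.
  apply/seteqP; split=> // X critX.
  have [tau [tauP _]] := tangles_at_nonempty critX.
  have [tauG _] := tauP; have sep0 : separations G (set0, setT).
    by split=> [||u v []]; rewrite /= ?set0U ?set0I.
  by have [] := tangle_or tauG sep0 => /(tangle_infinite tauG); apply;
    apply: sub_finite_set Vfin.
(* For critical X an injection of nat into the components lifts through two power sets and embeds
   2^(2^nat) into the tangles at X. Each tangle remembers X as its least free set, so these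
   embeddings have disjoint ranges. *)
- have /choice[g gP] : forall X,
      exists g : set (set nat) -> set (set V * set V),
      crit G X -> (forall P, tangles_at G X (g P)) /\ injective g.
    move=> X; have [critX|ncrit] := pselect (crit G X); last first.
      by exists (fun=> set0).
    have [_ /infinite_set_type/infinite_injection[d dinj]] := critX.
    have {}dinj := image_injective (image_injective dinj).
    have /pcard_leP/injfunPex[g gfun ginj] :
        [set: set (set nat)] #<= tangles_at G X.
      rewrite (card_le_eqr (card_tangles_at critX)).
      by apply: (@card_le_inj _ _ _ _ (fun P => (fun A => d @` A) @` P)) => //;
        apply: in2W.
    exists g => _; split=> [P|P Q]; first exact: gfun.
    by apply: ginj; rewrite inE.
  apply: (@card_le_inj _ _ _ _ (fun XP => g XP.1 XP.2)).
    by move=> [X P] [/= critX _]; have [/(_ P)[]] := gP X critX.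
  move=> [X P] [Y Q] /set_mem[/= critX _] /set_mem[/= critY _] E.
  have [gX ginj] := gP X critX; have [gY _] := gP Y critY.
  have XY : X = Y by have [_ <-] := gX P; have [_ <-] := gY Q; rewrite E.
  by subst Y; rewrite (ginj _ _ E).
Qed.
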